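(* For $r\ge 4$ let $\mathcal D_r=\{\sigma\in W_r:\wp(\sigma(\tilde\alpha+\rho)-\rho)>0\}$ be the Weyl alternation set of the Lie algebra of type $D_r$, let $M_r\subset\mathcal D_r$ be the subset of elements that do not contain $s_1$ in any reduced word decomposition, and let $N_r=\mathcal D_r\setminus M_r$ be the subset of elements that contain $s_1$. Then for all $r\ge 8$: \[|N_r|=|N_{r-1}|+|N_{r-2}|+3|N_{r-3}|+|N_{r-4}|,\] \[|M_r|=|N_r|+|N_{r-1}|=2|N_{r-1}|+|N_{r-2}|+3|N_{r-3}|+|N_{r-4}|,\] \[|\mathcal D_r|=|M_r|+|N_r|=2|N_r|+|N_{r-1}|=3|N_{r-1}|+2|N_{r-2}|+6|N_{r-3}|+2|N_{r-4}|,\] where $|N_4|=4$, $|N_5|=7$, $|N_6|=14$, $|N_7|=34$.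
   Context: Type $D_r$ ($\mathfrak{so}_{2r}(\mathbb C)$, $r\ge 4$): simple roots $\alpha_i=\varepsilon_i-\varepsilon_{i+1}$ for $1\le i\le r-1$ and $\alpha_r=\varepsilon_{r-1}+\varepsilon_r$; positive roots $\Phi^+=\{\varepsilon_i-\varepsilon_j,\varepsilon_i+\varepsilon_j:1\le i<j\le r\}$; highest root $\tilde\alpha=\varepsilon_1+\varepsilon_2=\alpha_1+2\alpha_2+\cdots+2\alpha_{r-2}+\alpha_{r-1}+\alpha_r$; $\rho=\frac12\sum_{\alpha\in\Phi^+}\alpha$. $s_i$ denotes the simple reflection in $\alpha_i$, and $W_r$ is the Weyl group generated by $s_1,\dots,s_r$. $\wp(\xi)$ is Kostant's partition function: the number of ways $\xi$ may be written as a nonnegative integral sum of positive roots. *)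

(* Defs.v *)
From HB Require Import structures.
From mathcomp Require Import all_boot all_order all_algebra.
From mathcomp Require Import finmap.
From mathcomp Require Import boolp classical_sets functions cardinality.

Set Implicit Arguments.
Unset Strict Implicit.
Unset Printing Implicit Defensive.

Import Order.TTheory GRing.Theory Num.Theory.
Local Open Scope classical_set_scope.
Local Open Scope ring_scope.

(* [fset_set A] is the finite set underlying [A], and [fset0] when [A] is
   infinite; the sets counted below (subsets of a finite Weyl group, and the
   decompositions of a vector into positive roots, all of which have positive
   height) are finite. *)
Definition card (T : choiceType) (A : set T) : nat := #|` fset_set A|%fset.

(* Indices are 0-based throughout: [eps r k] is the vector epsilon_{k+1} of
   the dual Cartan subalgebra, identified with rational column vectors. *)
Definition eps (r k : nat) : 'cV[rat]_r := \col_(j < r) (j == k :> nat)%:R.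

(* alpha_{i+1} *)
Definition simple_root (r : nat) (i : 'I_r) : 'cV[rat]_r :=
  if (i.+1 < r)%N then eps r i - eps r i.+1 else eps r r.-2 + eps r r.-1.

Definition posidx (r : nat) : finType :=
  {p : 'I_r * 'I_r * bool | (p.1.1 < p.1.2)%N}.

(* The indices ((i, j), false) and ((i, j), true), i < j, stand for
   eps_i - eps_j and eps_i + eps_j; this enumerates the positive roots without
   repetition. *)
Definition posroot (r : nat) (p : posidx r) : 'cV[rat]_r :=
  let: (i, j, b) := val p in
  if b then eps r i + eps r j else eps r i - eps r j.

Definition highest_root (r : nat) : 'cV[rat]_r := eps r 0 + eps r 1.

Definition rho (r : nat) : 'cV[rat]_r := 2^-1 *: \sum_(p : posidx r) posroot p.

Definition dot (r : nat) (u v : 'cV[rat]_r) : rat := \sum_i u i 0 * v i 0.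

(* Matrix of the reflection v |-> v - (2 (v, a) / (a, a)) a. *)
Definition reflection (r : nat) (a : 'cV[rat]_r) : 'M[rat]_r :=
  1%:M - (2 / dot a a) *: (a *m a^T).

Definition simple_refl (r : nat) (i : 'I_r) : 'M[rat]_r :=
  reflection (simple_root i).

(* The subgroup of GL_r generated by the simple reflections. *)
Inductive weyl (r : nat) : 'M[rat]_r -> Prop :=
| weyl_refl i : weyl (simple_refl i)
| weyl_one : weyl 1%:M
| weyl_mul s t : weyl s -> weyl t -> weyl (s *m t)
| weyl_inv s : weyl s -> weyl (invmx s).

Definition word_prod (r : nat) (w : seq 'I_r) : 'M[rat]_r :=
  \big[mulmx/1%:M]_(i <- w) simple_refl i.

Definition reduced_word (r : nat) (s : 'M[rat]_r) (w : seq 'I_r) : Prop :=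
  word_prod w = s /\
  forall w' : seq 'I_r, word_prod w' = s -> (size w <= size w')%N.

(* The letter 0 is the reflection s_1. *)
Definition contains_s1 (r : nat) (w : seq 'I_r) : bool :=
  has (fun i : 'I_r => i == 0%N :> nat) w.

Definition kostant (r : nat) (xi : 'cV[rat]_r) : nat :=
  card [set m : {ffun posidx r -> nat} |
         \sum_(p : posidx r) posroot p *+ m p = xi].

Definition Dset (r : nat) : set 'M[rat]_r :=
  [set s | weyl s /\
           (0 < kostant (s *m (highest_root r + rho r) - rho r))%N].

Definition Mset (r : nat) : set 'M[rat]_r :=
  [set s | Dset s /\
           forall w : seq 'I_r, reduced_word s w -> ~~ contains_s1 w].

Definition Nset (r : nat) : set 'M[rat]_r := @Dset r `\` @Mset r.

Definition cardD (r : nat) : nat := card (@Dset r).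
Definition cardM (r : nat) : nat := card (@Mset r).
Definition cardN (r : nat) : nat := card (@Nset r).

(* Main.v *)
Require Import Defs.
From mathcomp Require Import all_boot all_order all_algebra.
From mathcomp Require Import fingroup perm finmap.
From mathcomp Require Import boolp classical_sets cardinality.
From mathcomp Require Import ring lra zify.

Set Implicit Arguments.
Unset Strict Implicit.
Unset Printing Implicit Defensive.

Import Order.TTheory GRing.Theory Num.Theory.

(** Put L = (highest root) + rho = (r, r-1, r-3, r-4, ..., 1, 0). An element
sigma of the Weyl group is determined by sigma L, and the vectors sigma L are
exactly the arrangements of the entries of L in any order and with any signs
(the entry 0 makes the parity condition on the signs invisible). So counting
the alternation set amounts to counting the arrangements s for which s - rho is
a sum of positive roots, that is, whose partial sums stay nonnegative, with an
extra condition at the last coordinate ([cone_root_sum], [root_sum_cone]; the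
remaining integrality condition, a parity, is automatic).

The subset of elements avoiding s_1 is {sigma : sigma eps_1 = eps_1}, that is,
the arrangements that begin with r ([avoids_s1P]). This and the injectivity of
sigma |-> sigma L ([weyl_lambda_rho_inj]) are two cases of one fact: for a
reduced word s_(i_1) ... s_(i_k) of sigma and a dominant vector l, l - sigma l
is the sum of the (l, alpha_(i_j)) beta_j with
beta_j = s_(i_1) ... s_(i_(j-1)) alpha_(i_j) positive, so a word whose product
fixes l uses only letters orthogonal to l ([displacement]). Surjectivity
([arrangement_weyl]) is the usual descent to the dominant chamber.

To count, read an arrangement from left to right. The k largest entries of L
exceed the first k coordinates of rho by 2 in total as soon as k >= 2, so the
first k entries of an admissible arrangement fall short of the k largest ones
by at most 2. The set of the first k entries is thus described by a partition
of size at most 2, and [fillings] is a walk on the four states 0, (1), (2) and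
(1,1). With a_p the number of completions from the state 0 when p is the next
coordinate of rho, the transitions ([count_0S], [count_1S], [count_2S],
[count_11S]) give a_p = a_(p-1) + a_(p-2) + 3 a_(p-3) + a_(p-4). Since r - 2 is
missing from L, the walk begins as if in the state (2): the first entry is r,
leading to (1), or r-1, leading to (1,1) and from there necessarily to 0.
Hence |N_r| = a_(r-3) and |M_r| = a_(r-3) + a_(r-4). *)

(** * Positive roots and rho *)

Section Roots.
Local Open Scope ring_scope.
Implicit Types (r : nat).

Lemma dotE r (u v : 'cV[rat]_r) : dot u v = (u^T *m v) 0 0.
Proof. by rewrite mxE; apply: eq_bigr => i _; rewrite mxE. Qed.

Lemma dotC r (u v : 'cV[rat]_r) : dot u v = dot v u.
Proof. by apply: eq_bigr => i _; rewrite mulrC. Qed.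

Lemma dotDr r (u v w : 'cV[rat]_r) : dot u (v + w) = dot u v + dot u w.
Proof. by rewrite !dotE mulmxDr mxE. Qed.

Lemma dotZr r c (u v : 'cV[rat]_r) : dot u (c *: v) = c * dot u v.
Proof. by rewrite !dotE -scalemxAr mxE. Qed.

Lemma dotNr r (u v : 'cV[rat]_r) : dot u (- v) = - dot u v.
Proof. by rewrite -scaleN1r dotZr mulN1r. Qed.

Lemma dotDl r (u v w : 'cV[rat]_r) : dot (u + v) w = dot u w + dot v w.
Proof. by rewrite dotC dotDr !(dotC w). Qed.

Lemma dotNl r (u v : 'cV[rat]_r) : dot (- u) v = - dot u v.
Proof. by rewrite dotC dotNr dotC. Qed.

Lemma dot0r r (u : 'cV[rat]_r) : dot u 0 = 0.
Proof. by rewrite dotE mulmx0 mxE. Qed.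

Lemma dot_mulmx r (A : 'M[rat]_r) (u v : 'cV[rat]_r) :
  dot (A *m u) v = dot u (A^T *m v).
Proof. by rewrite !dotE trmx_mul mulmxA. Qed.

Lemma dot_eps r (k : 'I_r) (v : 'cV[rat]_r) : dot (eps r k) v = v k 0.
Proof.
rewrite /dot (bigD1 k) //= big1 => [|i ik]; rewrite mxE ?eqxx ?mul1r ?addr0 //.
by rewrite val_eqE (negPf ik) mul0r.
Qed.

(** With a < b these are all the positive roots; keeping the sign as a
boolean exponent treats both kinds at once. *)
Definition pair_root r (a b : 'I_r) (c : bool) : 'cV[rat]_r :=
  eps r a + (-1) ^+ c *: eps r b.

Definition positive r (v : 'cV[rat]_r) : Prop :=
  exists a b : 'I_r, (a < b)%N /\ exists c, v = pair_root a b c.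

Lemma dot_pair_root r (a b : 'I_r) c (v : 'cV[rat]_r) :
  dot (pair_root a b c) v = v a 0 + (-1) ^+ c * v b 0.
Proof. by rewrite dotDl dot_eps dotC dotZr dotC dot_eps. Qed.

Lemma posroot_pair r (p : posidx r) :
  posroot p = pair_root (val p).1.1 (val p).1.2 (~~ (val p).2).
Proof.
rewrite /posroot /pair_root; case: (val p) => [[i j] []] /=.
  by rewrite expr0 scale1r.
by rewrite expr1 scaleN1r.
Qed.

Lemma positiveP r (v : 'cV[rat]_r) : positive v <-> exists p, v = posroot p.
Proof.
split=> [[a [b [ab [c ->]]]]|[p ->]].
  by exists (exist _ (a, b, ~~ c) ab); rewrite posroot_pair /= negbK.
rewrite posroot_pair; exists (val p).1.1, (val p).1.2; split; first exact: valP p.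
by eexists.
Qed.

(** For vectors with distinct indices a < b, being positive on eps_a - eps_b and on
eps_a + eps_b is a bound on one absolute value. *)
Definition strictly_dominant r (x : 'cV[rat]_r) : Prop :=
  forall a b : 'I_r, (a < b)%N -> `|x b 0| < x a 0.

Definition dominant r (x : 'cV[rat]_r) : Prop :=
  forall a b : 'I_r, (a < b)%N -> `|x b 0| <= x a 0.

Lemma strictly_dominant_gt0 r (x v : 'cV[rat]_r) :
  strictly_dominant x -> positive v -> 0 < dot v x.
Proof.
move=> hx [a [b [ab [c ->]]]]; rewrite dot_pair_root.
by have := hx _ _ ab; rewrite real_ltr_norml ?num_real //; case: c; lra.
Qed.

Lemma dominant_ge0 r (x v : 'cV[rat]_r) :
  dominant x -> positive v -> 0 <= dot v x.
Proof.
move=> hx [a [b [ab [c ->]]]]; rewrite dot_pair_root.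
by have := hx _ _ ab; rewrite ler_norml; case: c; lra.
Qed.

Lemma sum_posidx r (F : 'I_r * 'I_r * bool -> rat) :
  \sum_(p : posidx r) F (val p) =
  \sum_(i < r) \sum_(j < r | (i < j)%N) (F (i, j, true) + F (i, j, false)).
Proof.
transitivity (\sum_(p : 'I_r * 'I_r * bool | (p.1.1 < p.1.2)%N) F p).
  by rewrite (big_sub (fun p : 'I_r * 'I_r * bool => (p.1.1 < p.1.2)%N) F).
rewrite pair_big_dep /=.
rewrite (eq_bigr (fun p => \sum_(b : bool) F (p.1, p.2, b))); last first.
  by move=> p _; rewrite big_bool.
rewrite pair_big_dep /=; apply: eq_big => [[[i j] b]|[[i j] b]] //=.
by rewrite andbT.
Qed.

Lemma rhoE r : rho r = \col_(j < r) (r.-1 - j)%N%:R.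
Proof.
apply/matrixP=> k z; rewrite !ord1 {z} !mxE summxE.
pose F (q : 'I_r * 'I_r * bool) := pair_root q.1.1 q.1.2 (~~ q.2) k 0.
have -> : \sum_(p : posidx r) posroot p k 0 = \sum_(p : posidx r) F (val p).
  by apply: eq_bigr => p _; rewrite posroot_pair.
rewrite sum_posidx /F /=.
rewrite (eq_bigr (fun i => (2 * (k == i)%:R) * (r.-1 - i)%N%:R)); last first.
  move=> i _; rewrite (eq_bigr (fun=> 2 * (k == i)%:R)); last first.
    by move=> j _; rewrite !mxE !val_eqE expr0 expr1; ring.
  rewrite sumr_const [RHS]mulr_natr; congr (_ *+ _).
  by rewrite -sum1_card -(big_geq_mkord _ _ xpredT (fun=> 1%N)) sum_nat_const_nat muln1; lia.
rewrite (bigD1 k) //= big1 => [|i ik]; last by rewrite eq_sym (negPf ik) mulr0 mul0r.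
by rewrite eqxx mulr1 addr0 mulrA mulVf ?mul1r.
Qed.

End Roots.

(** * Simple reflections and words *)

Section Words.
Local Open Scope ring_scope.
Implicit Types (r : nat).

Lemma simple_root_pair r (i : 'I_r) : (1 < r)%N ->
  exists a b : 'I_r, (a < b)%N /\ exists c, simple_root i = pair_root a b c /\
    if (i.+1 < r)%N then [/\ c, a = i :> nat & b = i.+1 :> nat]
    else [/\ ~~ c, a = r.-2 :> nat & b = r.-1 :> nat].
Proof.
move=> r1; rewrite /simple_root; case: ifP => ir.
  exists i, (Ordinal ir); split=> //; exists true; split=> //.
  by rewrite /pair_root expr1 scaleN1r.
have h1 : (r.-2 < r)%N by lia.
have h2 : (r.-1 < r)%N by lia.
exists (Ordinal h1), (Ordinal h2); split=> /=; first lia.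
by exists false; split=> //; rewrite /pair_root expr0 scale1r.
Qed.

Lemma positive_simple r (i : 'I_r) : (1 < r)%N -> positive (simple_root i).
Proof.
move=> /(simple_root_pair i)[a [b [ab [c [-> _]]]]].
by exists a, b; split=> //; exists c.
Qed.

Lemma dot_pair_self r (a b : 'I_r) c : (a < b)%N ->
  dot (pair_root a b c) (pair_root a b c) = 2.
Proof.
move=> ab; rewrite dot_pair_root !mxE !val_eqE !eqxx.
have -> : (a == b) = false by apply/eqP => e; move: ab; rewrite e ltnn.
have -> : (b == a) = false by apply/eqP => e; move: ab; rewrite e ltnn.
by case: c; rewrite /= ?expr0 ?expr1; ring.
Qed.

Lemma dot_positive_self r (v : 'cV[rat]_r) : positive v -> dot v v = 2.
Proof. by case=> a [b [ab [c ->]]]; exact: dot_pair_self. Qed.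

Lemma reflectionE r (a v : 'cV[rat]_r) : dot a a = 2 ->
  reflection a *m v = v - dot a v *: a.
Proof.
move=> ha; rewrite /reflection ha divff // scale1r mulmxBl mul1mx -mulmxA.
by rewrite [a^T *m v]mx11_scalar -dotE mul_mx_scalar.
Qed.

Lemma simple_reflE r (i : 'I_r) (v : 'cV[rat]_r) : (1 < r)%N ->
  simple_refl i *m v = v - dot (simple_root i) v *: simple_root i.
Proof. by move=> r1; apply/reflectionE/dot_positive_self/positive_simple. Qed.

(** A simple reflection exchanges two coordinates, with or without a sign change of
both, so it permutes absolute values of coordinates. *)
Lemma simple_refl_coord r (i : 'I_r) : (1 < r)%N ->
  exists (t : 'S_r) (e : 'I_r -> bool), forall (v : 'cV[rat]_r) k,
    (simple_refl i *m v) k 0 = (-1) ^+ e k * v (t k) 0.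
Proof.
move=> r1; have [a [b [ab [c [hi _]]]]] := simple_root_pair i r1.
exists (tperm a b), (fun k => ((k == a) || (k == b)) && ~~ c) => v k.
have ba : (b == a) = false by apply/eqP => e; move: ab; rewrite e ltnn.
rewrite simple_reflE // hi dot_pair_root !mxE !val_eqE.
case: tpermP => [->|->|/eqP/negPf-> /eqP/negPf->]; rewrite ?eqxx ?ba 1?eq_sym ?ba /=;
  case: c {hi}; rewrite /= ?expr0 ?expr1; ring.
Qed.

Lemma simple_refl_tr r (i : 'I_r) : (simple_refl i)^T = simple_refl i.
Proof.
by rewrite /simple_refl /reflection linearB linearZ /= trmx1 trmx_mul trmxK.
Qed.

Lemma col_mx_ext r (A B : 'M[rat]_r) :
  (forall v : 'cV[rat]_r, A *m v = B *m v) -> A = B.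
Proof.
move=> h; apply/matrixP => i j.
by have /matrixP/(_ i 0) := h (delta_mx j 0); rewrite -!colE !mxE.
Qed.

Lemma simple_reflK r (i : 'I_r) : (1 < r)%N ->
  simple_refl i *m simple_refl i = 1%:M.
Proof.
move=> r1; apply: col_mx_ext => v; rewrite -mulmxA !simple_reflE // mul1mx.
rewrite dotDr dotNr dotZr dot_positive_self; last exact: positive_simple.
by apply/matrixP => k z; rewrite !mxE; ring.
Qed.

Lemma word_prod_nil r : word_prod ([::] : seq 'I_r) = 1%:M.
Proof. exact: big_nil. Qed.

Lemma word_prod_cons r (i : 'I_r) w :
  word_prod (i :: w) = simple_refl i *m word_prod w.
Proof. exact: big_cons. Qed.

Lemma word_prod_cat r (w1 w2 : seq 'I_r) :
  word_prod (w1 ++ w2) = word_prod w1 *m word_prod w2.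
Proof.
elim: w1 => [|i w IH]; first by rewrite word_prod_nil mul1mx.
by rewrite cat_cons !word_prod_cons IH mulmxA.
Qed.

Lemma word_prod_rcons r (w : seq 'I_r) i :
  word_prod (rcons w i) = word_prod w *m simple_refl i.
Proof. by rewrite -cats1 word_prod_cat word_prod_cons word_prod_nil mulmx1. Qed.

Lemma word_prod_rev r (w : seq 'I_r) : word_prod (rev w) = (word_prod w)^T.
Proof.
elim: w => [|i w IH]; first by rewrite word_prod_nil trmx1.
by rewrite rev_cons word_prod_rcons IH word_prod_cons trmx_mul simple_refl_tr.
Qed.

Lemma word_prod_orth r (w : seq 'I_r) : (1 < r)%N ->
  (word_prod w)^T *m word_prod w = 1%:M.
Proof.
move=> r1; elim: w => [|i w IH]; first by rewrite word_prod_nil trmx1 mulmx1.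
rewrite word_prod_cons trmx_mul simple_refl_tr mulmxA -(mulmxA _^T).
by rewrite simple_reflK // mulmx1.
Qed.

Lemma weylP r (s : 'M[rat]_r) : (1 < r)%N ->
  weyl s <-> exists w, s = word_prod w.
Proof.
move=> r1; split=> [|[w ->]].
  elim=> [i||s1 s2 _ [w1 ->] _ [w2 ->]|_ _ [w ->]].
  - by exists [:: i]; rewrite word_prod_cons word_prod_nil mulmx1.
  - by exists [::]; rewrite word_prod_nil.
  - by exists (w1 ++ w2); rewrite word_prod_cat.
  - exists (rev w); rewrite word_prod_rev.
    have h := word_prod_orth w r1; have [hU _] := mulmx1_unit (mulmx1C h).
    by rewrite -[LHS]mul1mx -h mulmxK.
elim: w => [|i w IH]; first by rewrite word_prod_nil; exact: weyl_one.
by rewrite word_prod_cons; apply: weyl_mul IH; exact: weyl_refl.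
Qed.

Lemma exists_reduced_word r (w : seq 'I_r) :
  exists w', reduced_word (word_prod w) w'.
Proof.
have [n] := ubnP (size w); elim: n w => // n IH w szw.
have [h|h] := pselect (reduced_word (word_prod w) w); first by exists w.
have [w' [e sz]] : exists w' : seq 'I_r,
    word_prod w' = word_prod w /\ (size w' < size w)%N.
  apply: contrapT => h'; apply: h; split=> // w' e; rewrite leqNgt.
  by apply/negP => sz; apply: h'; exists w'.
by rewrite -e; apply: IH; exact: leq_trans sz _.
Qed.

Lemma reduced_word_rev r (s : 'M[rat]_r) w :
  reduced_word s w -> reduced_word s^T (rev w).
Proof.
case=> <- h; split=> [|w' e]; first exact: word_prod_rev.
by rewrite size_rev -(size_rev w'); apply: h; rewrite word_prod_rev e trmxK.
Qed.

(** The order of a and b and both signs are left free, which makes stability under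
reflections immediate; [root_sign] recovers the sign of the root. *)
Definition is_root r (v : 'cV[rat]_r) : Prop :=
  exists (a b : 'I_r) (x y : bool), a != b /\
    v = (-1) ^+ x *: eps r a + (-1) ^+ y *: eps r b.

Lemma positive_root r (v : 'cV[rat]_r) : positive v -> is_root v.
Proof.
case=> a [b [ab [c ->]]]; exists a, b, false, c; split.
  by apply/eqP => e; move: ab; rewrite e ltnn.
by rewrite scale1r.
Qed.

Lemma root_sign r (v : 'cV[rat]_r) :
  is_root v -> positive v \/ positive (- v).
Proof.
case=> a [b [x [y [ab ->]]]].
wlog: a b x y ab / (a < b)%N => [wl|lab].
  have [/wl|ba|/val_inj e] := ltngtP a b; first exact.
    by rewrite addrC; apply: wl; rewrite // eq_sym.
  by rewrite e eqxx in ab.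
case: x; [right|left]; exists a, b; split=> //.
  exists (~~ y); rewrite /pair_root opprD expr1 scaleN1r opprK -scaleNr.
  by case: y; rewrite ?expr0 ?expr1 ?opprK.
by exists y; rewrite scale1r.
Qed.

Lemma simple_refl_root r (i : 'I_r) (v : 'cV[rat]_r) : (1 < r)%N ->
  is_root v -> is_root (simple_refl i *m v).
Proof.
move=> r1 [a [b [x [y [ab ->]]]]].
have [t [e h]] := simple_refl_coord i r1.
have he (k : 'I_r) : simple_refl i *m eps r k =
    (-1) ^+ (e ((t^-1)%g k)) *: eps r ((t^-1)%g k).
  apply/matrixP => j z; rewrite !ord1 h !mxE !val_eqE.
  by rewrite (canF_eq (permK t)); case: eqP => [->|]; rewrite ?mulr0.
exists ((t^-1)%g a), ((t^-1)%g b), (x (+) e ((t^-1)%g a)), (y (+) e ((t^-1)%g b)).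
split; first by rewrite (inj_eq perm_inj).
by rewrite mulmxDr -!scalemxAr !he !scalerA !signr_addb.
Qed.

Lemma strictly_dominant_rho r : strictly_dominant (rho r).
Proof.
move=> a b ab; rewrite rhoE !mxE normr_nat ltr_nat.
by have := ltn_ord b; lia.
Qed.

Lemma dot_simple_rho r (i : 'I_r) : (1 < r)%N -> dot (simple_root i) (rho r) = 1.
Proof.
move=> r1; have [a [b [ab [c [-> h]]]]] := simple_root_pair i r1.
rewrite dot_pair_root rhoE !mxE; have := ltn_ord b.
case: ifP h => ir [hc ha hb] br.
  rewrite hc expr1 (_ : (r.-1 - a)%N = (r.-1 - b).+1); last lia.
  by rewrite -natr1; ring.
have -> : (r.-1 - a)%N = 1%N by lia.
have -> : (r.-1 - b)%N = 0%N by lia.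
by rewrite mulr0 addr0.
Qed.

Lemma dot_pair_int r (u v : 'cV[rat]_r) :
  positive u -> (forall k, v k 0 \is a Num.int) -> dot u v \is a Num.int.
Proof.
case=> a [b [_ [c ->]]] hv; rewrite dot_pair_root.
by rewrite rpredD ?rpredM ?rpredX ?rpredN ?rpred1.
Qed.

Lemma positive_int r (v : 'cV[rat]_r) k : positive v -> v k 0 \is a Num.int.
Proof.
case=> a [b [_ [c ->]]]; rewrite !mxE.
by rewrite rpredD ?rpredM ?rpredX ?rpredN ?rpred1 ?rpred_nat.
Qed.

Lemma int_lt2 (x : rat) : x \is a Num.int -> x < 2 -> x <= 1.
Proof. by case/intrP => n ->; rewrite (ltr_int _ n 2) lerz1; lia. Qed.

Lemma int_gt0 (x : rat) : x \is a Num.int -> 0 < x -> 1 <= x.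
Proof. by case/intrP => n ->; rewrite ltr0z ler1z; lia. Qed.

Lemma dot_gt0 r (v : 'cV[rat]_r) : v != 0 -> 0 < dot v v.
Proof.
move=> v0; rewrite lt_neqAle sumr_ge0 ?andbT; last by move=> i _; rewrite -expr2 sqr_ge0.
apply: contraNneq v0 => /esym/eqP; rewrite psumr_eq0; last first.
  by move=> i _; rewrite -expr2 sqr_ge0.
move=> /allP h; apply/eqP/matrixP => i z; rewrite !ord1 mxE.
by have /= := h i (mem_index_enum i); rewrite mulf_eq0 orbb => /eqP.
Qed.

(** Both roots have norm 2, so 0 < |u - v|^2 = 4 - 2 (u, v), and (u, v) is an
integer. *)
Lemma dot_positive_le1 r (u v : 'cV[rat]_r) :
  positive u -> positive v -> u != v -> dot u v <= 1.
Proof.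
move=> hu hv; rewrite -subr_eq0 => /dot_gt0.
rewrite dotDr !dotDl !dotNr !dotNl !dot_positive_self // (dotC v u) => h.
apply: int_lt2; last by lra.
by apply: dot_pair_int => // k; exact: positive_int.
Qed.

Lemma rho_int r k : rho r k 0 \is a Num.int.
Proof. by rewrite rhoE mxE rpred_nat. Qed.

(** The reflected root v' satisfies (v', rho) = (v, rho) - (v, alpha_i), since
(alpha_i, rho) = 1. Here (v, rho) >= 1 and (v, alpha_i) <= 1, so (v', rho) >= 0,
which excludes a negative root. *)
Lemma simple_refl_positive r (i : 'I_r) (v : 'cV[rat]_r) : (1 < r)%N ->
  positive v -> v != simple_root i -> positive (simple_refl i *m v).
Proof.
move=> r1 hv hi; have [//|hn] := root_sign (simple_refl_root i r1 (positive_root hv)).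
have hp := positive_simple i r1.
have := strictly_dominant_gt0 (@strictly_dominant_rho r) hn.
rewrite simple_reflE // dotNl dotDl dotNl (dotC (_ *: _)) dotZr (dotC (rho r)).
rewrite dot_simple_rho //.
have := int_gt0 (dot_pair_int hv (@rho_int r))
  (strictly_dominant_gt0 (@strictly_dominant_rho r) hv).
by have := dot_positive_le1 hp hv; rewrite eq_sym => /(_ hi); lra.
Qed.

End Words.

(** * Reduced words and stabilizers *)

Section Orbit.
Local Open Scope ring_scope.
Implicit Types (r : nat).

(** Apply the letters of w to v from the right to the left: the letter j at which
positivity is first lost reflects in the current root, because any other positive
root would stay positive. *)
Lemma positivity_lost r (w : seq 'I_r) (v : 'cV[rat]_r) : (1 < r)%N ->
  positive v -> ~ positive (word_prod w *m v) ->
  exists u j x, w = u ++ j :: x /\ word_prod x *m v = simple_root j.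
Proof.
move=> r1 hv; elim: w => [|j w IH]; first by rewrite word_prod_nil mul1mx.
have [hw hj|/IH[u [k [x [-> hx]]]] _] := pselect (positive (word_prod w *m v)).
  exists [::], j, w; split=> //; apply: contrapT => /eqP ne; apply: hj.
  by rewrite word_prod_cons -mulmxA; exact: simple_refl_positive.
by exists (j :: u), k, x.
Qed.

(** Conjugating a reflection by an isometry gives the reflection in the image of the
root; the product of a word is an isometry. *)
Lemma simple_refl_conj r (w : seq 'I_r) i j : (1 < r)%N ->
  word_prod w *m simple_root i = simple_root j ->
  word_prod w *m simple_refl i = simple_refl j *m word_prod w.
Proof.
move=> r1 h; apply: col_mx_ext => v; rewrite -!mulmxA !simple_reflE //.
rewrite mulmxBr -scalemxAr h -h dot_mulmx mulmxA word_prod_orth //.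
by rewrite mul1mx.
Qed.

(** Deletion argument: otherwise u = y ++ j :: z where z sends alpha_i to alpha_j, so
s_j z = z s_i and the two letters j and i can be deleted from the word. *)
Lemma reduced_word_positive r (s : 'M[rat]_r) u i x : (1 < r)%N ->
  reduced_word s (u ++ i :: x) -> positive (word_prod u *m simple_root i).
Proof.
move=> r1 [hs hm]; apply: contrapT => hn.
have [y [j [z [eu ez]]]] := positivity_lost r1 (positive_simple i r1) hn.
have := hm (y ++ z ++ x); rewrite eu -hs eu !size_cat /=.
suff -> : word_prod (y ++ z ++ x) = word_prod ((y ++ j :: z) ++ i :: x).
  by move=> /(_ erefl); lia.
rewrite -catA /= !word_prod_cat !word_prod_cons word_prod_cat word_prod_cons.
rewrite (mulmxA (word_prod z)) (simple_refl_conj r1 ez) !mulmxA.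
by rewrite -(mulmxA (word_prod y) (simple_refl j) (simple_refl j)) simple_reflK // mulmx1.
Qed.

(** By induction on prefixes, l - s l is the sum over the letters i of w of
(alpha_i, l) beta_i with beta_i a positive root ([reduced_word_positive]). Paired with m each
term is nonnegative, and it vanishes only if (alpha_i, l) = 0. *)
Lemma displacement r (s : 'M[rat]_r) w (l m : 'cV[rat]_r) : (1 < r)%N ->
  reduced_word s w -> dominant l -> strictly_dominant m ->
  dot (l - s *m l) m = 0 -> {in w, forall i, dot (simple_root i) l = 0}.
Proof.
move=> r1 hw hl hm; have [hs _] := hw; rewrite -{}hs => h0.
suff H : forall u x, w = u ++ x -> 0 <= dot (l - word_prod u *m l) m /\
    (dot (l - word_prod u *m l) m = 0 ->
     {in u, forall i, dot (simple_root i) l = 0}).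
  by have [|_ h] := H w [::]; [rewrite cats0 | exact: h].
elim/last_ind=> [|u i IH] x ew.
  by rewrite word_prod_nil mul1mx subrr dotC dot0r.
rewrite cat_rcons in ew; have [IH1 IH2] := IH _ ew.
have hp : positive (word_prod u *m simple_root i).
  by move: hw; rewrite ew; exact: reduced_word_positive.
have e : l - word_prod (rcons u i) *m l = (l - word_prod u *m l) +
    dot (simple_root i) l *: (word_prod u *m simple_root i).
  rewrite word_prod_rcons -mulmxA simple_reflE // mulmxBr -scalemxAr.
  by rewrite opprD opprK addrA.
rewrite e dotDl (dotC (_ *: _)) dotZr (dotC m).
have h1 := strictly_dominant_gt0 hm hp.
have h2 := dominant_ge0 hl (positive_simple i r1).
have h3 : 0 <= dot (simple_root i) l * dot (word_prod u *m simple_root i) m.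
  by rewrite mulr_ge0 // ltW.
split=> [|h k]; first lra.
rewrite mem_rcons inE => /orP[/eqP->|]; last by apply: IH2; lra.
have /eqP : dot (simple_root i) l * dot (word_prod u *m simple_root i) m = 0.
  by lra.
by rewrite mulf_eq0 (gt_eqF h1) orbF => /eqP.
Qed.

Definition lambda_rho r : 'cV[rat]_r := highest_root r + rho r.

(** The coordinates of [lambda_rho]; the entry r - 2 is skipped. *)
Definition level r k : nat := (r.-1 - k + (k < 2))%N.

Lemma lambda_rhoE r : lambda_rho r = \col_(j < r) (level r j)%:R.
Proof.
apply/matrixP => i z; rewrite !ord1 /lambda_rho rhoE !mxE /level addnC natrD; congr (_ + _).
by case: (i : nat) => [|[|]]; rewrite /= ?addr0 ?add0r.
Qed.

Lemma level_lt r (a b : 'I_r) : (2 < r)%N -> (a < b)%N -> (level r b < level r a)%N.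
Proof. by move=> r2 ab; have := ltn_ord b; rewrite /level; lia. Qed.

Lemma strictly_dominant_lambda_rho r : (2 < r)%N ->
  strictly_dominant (lambda_rho r).
Proof.
by move=> r2 a b ab; rewrite lambda_rhoE !mxE normr_nat ltr_nat level_lt.
Qed.

Lemma strictly_dominantW r (v : 'cV[rat]_r) : strictly_dominant v -> dominant v.
Proof. by move=> h a b /h /ltW. Qed.

Lemma weyl_orth r (s : 'M[rat]_r) : (1 < r)%N -> weyl s ->
  [/\ weyl s^T, s^T *m s = 1%:M & s *m s^T = 1%:M].
Proof.
move=> r1 /(weylP _ r1)[w ->]; have h := word_prod_orth w r1; split=> //.
  by rewrite -word_prod_rev; apply/weylP => //; exists (rev w).
exact: mulmx1C.
Qed.

(** A reduced word of t^-1 s fixes a strictly dominant vector, to which no simple root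
is orthogonal; by [displacement] the word is empty. *)
Lemma weyl_lambda_rho_inj r (s t : 'M[rat]_r) : (2 < r)%N -> weyl s -> weyl t ->
  s *m lambda_rho r = t *m lambda_rho r -> s = t.
Proof.
move=> r2 hs ht e; have r1 := ltnW r2.
have [tw tT tt] := weyl_orth r1 ht.
have [w0 ew0] : exists w, t^T *m s = word_prod w.
  by apply/weylP => //; exact: weyl_mul.
have [w hw] := exists_reduced_word w0; rewrite -ew0 in hw.
have hL := strictly_dominant_lambda_rho r2.
have H := displacement r1 hw (strictly_dominantW hL) hL.
have {}H : {in w, forall i : 'I_r, dot (simple_root i) (lambda_rho r) = 0}.
  by apply: H; rewrite -mulmxA e mulmxA tT mul1mx subrr dotC dot0r.
have w0' : w = [::].
  case: w H {hw} => // i w /(_ i (mem_head _ _)) h.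
  by have := strictly_dominant_gt0 hL (positive_simple i r1); rewrite h ltxx.
have [] := hw; rewrite w0' word_prod_nil => h _.
by rewrite -[s]mul1mx -tt -mulmxA -h mulmx1.
Qed.

Lemma dominant_eps0 r (k0 : 'I_r) : k0 = 0%N :> nat -> dominant (eps r k0).
Proof.
move=> h a b ab; rewrite !mxE normr_nat h ler_nat.
by case: (b : nat) ab; case: (a : nat).
Qed.

Lemma simple_root_eps0 r (i k0 : 'I_r) : (2 < r)%N -> k0 = 0%N :> nat ->
  dot (simple_root i) (eps r k0) = (i == k0)%:R.
Proof.
move=> r2 hk; have r1 := ltnW r2; rewrite dotC dot_eps.
have [a [b [ab [c [-> h]]]]] := simple_root_pair i r1.
rewrite !mxE hk (_ : (0%N == b) = false); last by case: (b : nat) ab.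
rewrite mulr0 addr0 -(val_eqE i) /= hk eq_sym; congr (_%:R : rat); congr nat_of_bool.
by have := ltn_ord i; case: ifP h => ir [hc ha hb]; lia.
Qed.

Lemma word_prod_eps0 r (w : seq 'I_r) (k0 : 'I_r) : (2 < r)%N ->
  k0 = 0%N :> nat -> ~~ contains_s1 w -> word_prod w *m eps r k0 = eps r k0.
Proof.
move=> r2 hk; elim: w => [|i w IH]; first by rewrite word_prod_nil mul1mx.
rewrite /contains_s1 /= negb_or => /andP[hi /IH hw].
rewrite word_prod_cons -mulmxA hw simple_reflE; last exact: ltnW.
by rewrite simple_root_eps0 // -val_eqE /= hk (negPf hi) scale0r subr0.
Qed.

(** If s is a product of letters other than s_1 it fixes eps_1, hence preserves the first
coordinate of L, which is r. Conversely, this coordinate of s L is (s^-1 eps_1, L), so its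
being r = (eps_1, L) says that eps_1 - s^-1 eps_1 is orthogonal to L; [displacement],
applied to eps_1 and to the reversed words, excludes the only letter not orthogonal to
eps_1. *)
Lemma avoids_s1P r (s : 'M[rat]_r) (k0 : 'I_r) : (2 < r)%N ->
  k0 = 0%N :> nat -> weyl s ->
  (forall w, reduced_word s w -> ~~ contains_s1 w) <->
  (s *m lambda_rho r) k0 0 = r%:R.
Proof.
move=> r2 hk hs; have r1 := ltnW r2; have [sw sT ss] := weyl_orth r1 hs.
have L0 : lambda_rho r k0 0 = r%:R.
  by rewrite lambda_rhoE mxE hk /level; congr (_%:R); lia.
have e : (s *m lambda_rho r) k0 0 = dot (s^T *m eps r k0) (lambda_rho r).
  by rewrite dot_mulmx trmxK dot_eps.
split=> [h|h w hw].
  have [w0 ew0] := (weylP s r1).1 hs.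
  have [w hw] := exists_reduced_word w0; rewrite -ew0 in hw.
  have [hws _] := hw; have := word_prod_eps0 r2 hk (h w hw).
  by rewrite hws e => <-; rewrite mulmxA sT mul1mx dot_eps.
have H := displacement r1 (reduced_word_rev hw) (dominant_eps0 hk)
  (strictly_dominant_lambda_rho r2).
apply/hasPn => i iw; apply/negP => /eqP i0.
have := H _ i; rewrite mem_rev dotDl dotNl -e h dot_eps L0 subrr.
move=> /(_ erefl iw); rewrite simple_root_eps0 // -val_eqE /= hk i0 eqxx.
by move/eqP; rewrite oner_eq0.
Qed.

End Orbit.

(** * The orbit of the shifted highest root *)

Section Arrangements.
Local Open Scope ring_scope.
Implicit Types (r : nat) (s : seq int).

Definition vec r s : 'cV[rat]_r := \col_(j < r) (nth 0 s j)%:~R.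

Definition levels r : seq nat := [seq level r k | k : 'I_r].

Definition arrangement r s : bool := perm_eq (map absz s) (levels r).

Lemma size_levels r : size (levels r) = r.
Proof. by rewrite size_map size_enum_ord. Qed.

Lemma nth_levels r k : (k < r)%N -> nth 0%N (levels r) k = level r k.
Proof.
move=> kr; rewrite (nth_map (Ordinal kr)) ?size_enum_ord //.
by rewrite nth_enum_ord.
Qed.

Lemma size_arrangement r s : arrangement r s -> size s = r.
Proof. by move=> /perm_size; rewrite size_map size_levels. Qed.

Lemma vec_inj r s t : size s = r -> size t = r -> vec r s = vec r t -> s = t.
Proof.
move=> ss st /matrixP e; apply: (@eq_from_nth _ 0); rewrite ss ?st // => i ir.
by have := e (Ordinal ir) 0; rewrite !mxE /= => /intr_inj.
Qed.

Lemma vec_levels r : vec r (map Posz (levels r)) = lambda_rho r.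
Proof.
rewrite lambda_rhoE; apply/matrixP => i z; rewrite !mxE.
by rewrite (nth_map 0%N) ?size_levels // nth_levels.
Qed.

Lemma arrangement_levels r : arrangement r (map Posz (levels r)).
Proof. by rewrite /arrangement -map_comp (@eq_map _ _ _ id) ?map_id. Qed.

Lemma arrangement_refl r (i : 'I_r) s : (1 < r)%N -> arrangement r s ->
  exists2 s', arrangement r s' & simple_refl i *m vec r s = vec r s'.
Proof.
move=> r1 hs; have [t [e h]] := simple_refl_coord i r1.
exists [seq (-1) ^+ e k * nth 0 s (t k) | k : 'I_r].
  rewrite /arrangement -map_comp.
  rewrite (@eq_map _ _ _ ((fun k => absz (nth 0 s (nat_of_ord k))) \o t)); last first.
    by move=> k /=; rewrite abszMsign.
  rewrite map_comp; apply: perm_trans (hs).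
  have -> : map absz s = [seq absz (nth 0 s (nat_of_ord k)) | k : 'I_r].
    apply: (@eq_from_nth _ 0%N).
      by rewrite size_map size_image card_ord (size_arrangement hs).
    move=> k; rewrite size_map => ks; have kr : (k < r)%N by rewrite -(size_arrangement hs).
    rewrite (nth_map 0) // (nth_map (Ordinal kr)) ?size_enum_ord //.
    by rewrite nth_enum_ord.
  apply: perm_map; apply: uniq_perm; rewrite ?(map_inj_uniq (@perm_inj _ t)) ?enum_uniq //.
  move=> k; rewrite mem_enum; apply/mapP; exists ((t^-1)%g k); rewrite ?mem_enum //.
  by rewrite permKV.
apply/matrixP => k z; rewrite !ord1 h !mxE.
rewrite (nth_map k) ?size_enum_ord // nth_ord_enum rmorphM rmorphXn /=.
by rewrite rmorphN1.
Qed.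

Lemma weyl_arrangement r (g : 'M[rat]_r) : (1 < r)%N -> weyl g ->
  exists2 s, arrangement r s & g *m lambda_rho r = vec r s.
Proof.
move=> r1 /(weylP _ r1)[w ->]; elim: w => [|i w [s hs e]].
  exists (map Posz (levels r)); first exact: arrangement_levels.
  by rewrite word_prod_nil mul1mx vec_levels.
rewrite word_prod_cons -mulmxA e; exact: arrangement_refl.
Qed.

(** Dominance makes the absolute values decreasing and all entries but the last
nonnegative; the last one has the smallest absolute value, which is 0. *)
Lemma dominant_arrangement r s : (2 < r)%N -> arrangement r s ->
  (forall i : 'I_r, 0 <= dot (simple_root i) (vec r s)) ->
  vec r s = lambda_rho r.
Proof.
move=> r2 hs hd; have r1 := ltnW r2; have szs := size_arrangement hs.
have step k : (k.+1 < r)%N -> nth 0 s k.+1 <= nth 0 s k.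
  move=> kr; have := hd (Ordinal (ltnW kr)).
  have [a [b [ab [c [->]]]]] := simple_root_pair (Ordinal (ltnW kr)) r1.
  rewrite /= kr => -[-> ha hb]; rewrite dot_pair_root !mxE ha hb.
  by rewrite expr1 mulN1r subr_ge0 ler_int.
have last_step : 0 <= nth 0 s r.-2 + nth 0 s r.-1.
  have lr : (r.-1 < r)%N by lia.
  have := hd (Ordinal lr).
  have [a [b [ab [c [->]]]]] := simple_root_pair (Ordinal lr) r1.
  rewrite /= ifF; last by lia.
  move=> [/negPf-> ha hb]; rewrite dot_pair_root !mxE ha hb.
  by rewrite expr0 mul1r -rmorphD /= ler0z.
have h2 : `|nth 0 s r.-1| <= nth 0 s r.-2.
  by have := step r.-2; rewrite (_ : r.-2.+1 = r.-1); lia.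
have ge k : (k <= r.-2)%N -> nth 0 s r.-2 <= nth 0 s k.
  move=> kr; rewrite -(subKn kr); elim: (r.-2 - k)%N (leq_subr k r.-2) => [|n IH] hn.
    by rewrite subn0.
  apply: le_trans (IH (ltnW hn)) _.
  by have := step (r.-2 - n.+1)%N; rewrite -subSn // subSS; apply; lia.
have abs_le (x y : int) : `|x| <= y -> (`|x| <= `|y|)%N by lia.
have srt : sorted geq (map absz s).
  apply/(sortedP 0%N) => k; rewrite size_map => ks.
  rewrite !(nth_map 0) ?(ltnW ks) // /geq /=; rewrite szs in ks.
  have [ek|ek] := eqVneq k.+1 r.-1.
    rewrite ek (_ : k = r.-2); last lia.
    by apply: abs_le; exact: h2.
  apply: abs_le; rewrite ger0_norm; first exact: step.
  by apply: le_trans (ge k.+1 _); [exact: le_trans h2 | lia].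
have srtl : sorted geq (levels r).
  apply/(sortedP 0%N) => k; rewrite size_levels => ks.
  by rewrite !nth_levels // /level /=; lia.
have e : map absz s = levels r.
  apply: (sorted_eq _ _ srt srtl) hs => [x y z|x y]; rewrite /geq /=; lia.
apply/matrixP => k z; rewrite lambda_rhoE !ord1 !mxE -(nth_levels (ltn_ord k)) -e.
rewrite (nth_map 0) ?szs // natr_absz; congr (_%:~R); symmetry; apply: ger0_norm.
have [kr|kr] := leqP k r.-2; first by apply: le_trans (ge k kr); lia.
have : nth 0%N (map absz s) k = level r k by rewrite e nth_levels.
rewrite (nth_map 0) ?szs // /level; have := ltn_ord k; lia.
Qed.

Lemma arrangement_int r s k : vec r s k 0 \is a Num.int.
Proof. by rewrite mxE intr_int. Qed.

(** As long as some simple root is negative on the arrangement, the corresponding reflection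
raises its product with rho by at least 1, and this product is bounded on all arrangements.
The process ends at a dominant arrangement, which is L itself. *)
Lemma arrangement_weyl r s : (2 < r)%N -> arrangement r s ->
  exists2 g, weyl g & g *m lambda_rho r = vec r s.
Proof.
move=> r2 hs; have r1 := ltnW r2.
suff [w e] : exists w, word_prod w *m lambda_rho r = vec r s.
  by exists (word_prod w) => //; apply/weylP => //; exists w.
have bound t : arrangement r t ->
    dot (rho r) (vec r t) <= (r * sumn (levels r))%:R.
  move=> ht; rewrite natrM -(perm_sumn ht) sumnE big_map natr_sum mulr_sumr.
  rewrite (big_nth 0) big_mkord (size_arrangement ht); apply: ler_sum => k _.
  rewrite rhoE !mxE natr_absz; apply: le_trans (ler_norm _) _.
  by rewrite normrM normr_nat intr_norm ler_wpM2r // ler_nat; lia.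
have [n] : exists n : nat, (r * sumn (levels r))%:R - dot (rho r) (vec r s) < n%:R.
  exists (Num.truncn ((r * sumn (levels r))%:R - dot (rho r) (vec r s))).+1.
  by rewrite truncnS_gt.
elim: n s hs => [|n IH] s hs hn; first by have := bound s hs; lra.
have [hd|] := pselect (forall i : 'I_r, 0 <= dot (simple_root i) (vec r s)).
  by exists [::]; rewrite word_prod_nil mul1mx (dominant_arrangement r2 hs hd).
move=> /existsNP[i /negP]; rewrite -ltNge => hi.
have [s' hs' es] := arrangement_refl i r1 hs.
have h1 : dot (simple_root i) (vec r s) <= -1.
  have : 1 <= - dot (simple_root i) (vec r s).
    apply: int_gt0; last by lra.
    rewrite rpredN; apply: dot_pair_int; first exact: positive_simple.
    by move=> k; exact: arrangement_int.
  lra.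
have [|w ew] := IH s' hs'.
  rewrite -es simple_reflE // dotDr dotNr dotZr (dotC (rho r) (simple_root i)).
  by move: hn; rewrite dot_simple_rho // -natr1; lra.
exists (i :: w); rewrite word_prod_cons -mulmxA ew -es mulmxA simple_reflK //.
by rewrite mul1mx.
Qed.

End Arrangements.

(** * Positivity of the partition function *)

Section Kostant.
Local Open Scope ring_scope.
Implicit Types (r : nat) (s : seq int).

Definition root_sum r (xi : 'cV[rat]_r) : Prop :=
  exists m : {ffun posidx r -> nat}, \sum_(p : posidx r) posroot p *+ m p = xi.

Lemma dot_root_sum r (x : 'cV[rat]_r) (m : posidx r -> nat) :
  dot (\sum_(p : posidx r) posroot p *+ m p) x =
  \sum_(p : posidx r) dot (posroot p) x *+ m p.
Proof.
elim/big_rec2: _ => [|p y z _ <-]; first by rewrite dotC dot0r.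
by rewrite dotDl -scaler_nat (dotC (_ *: _)) dotZr mulr_natl (dotC x).
Qed.

Lemma posroot_rho_ge1 r (p : posidx r) : 1 <= dot (posroot p) (rho r).
Proof.
have hp : positive (posroot p) by apply/positiveP; exists p.
apply: int_gt0; last exact: strictly_dominant_gt0 (@strictly_dominant_rho r) hp.
by apply: dot_pair_int => // k; exact: rho_int.
Qed.

(** Pairing with rho bounds every multiplicity, since (alpha, rho) >= 1 for each positive
root alpha. *)
Lemma finite_root_sums r (xi : 'cV[rat]_r) :
  finite_set [set m : {ffun posidx r -> nat} |
              \sum_(p : posidx r) posroot p *+ m p = xi]%classic.
Proof.
pose N := (Num.truncn (dot xi (rho r))).+1.
apply: (@sub_finite_set _ _
  ((fun g : {ffun posidx r -> 'I_N} => [ffun p => nat_of_ord (g p)]) @` setT)%classic);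
  last exact: finite_image.
move=> m /= hm.
have hN p : (m p < N)%N.
  rewrite -(ltr_nat rat); apply: le_lt_trans (truncnS_gt _).
  rewrite -hm dot_root_sum (bigD1 p) //= -[leLHS]addr0; apply: lerD.
    by rewrite -[leRHS]mulr_natl ler_peMr // posroot_rho_ge1.
  apply: sumr_ge0 => q _; rewrite mulrn_wge0 //.
  exact: le_trans (posroot_rho_ge1 q).
exists [ffun p => Ordinal (hN p)] => //.
by apply/ffunP => p; rewrite !ffunE.
Qed.

Lemma kostant_gt0 r (xi : 'cV[rat]_r) : (0 < kostant xi)%N <-> root_sum xi.
Proof.
have fin := finite_root_sums xi; rewrite /kostant /card; split.
  rewrite cardfs_gt0 => /fset0Pn[m]; rewrite in_fset_set // inE => hm.
  by exists m.
case=> m hm; rewrite cardfs_gt0; apply/fset0Pn; exists m.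
by rewrite in_fset_set // inE.
Qed.

Lemma root_sum0 r : root_sum (0 : 'cV[rat]_r).
Proof. by exists [ffun=> 0%N]; apply: big1 => p _; rewrite ffunE mulr0n. Qed.

Lemma root_sumD r (u v : 'cV[rat]_r) : root_sum u -> root_sum v -> root_sum (u + v).
Proof.
case=> m1 <- [m2 <-]; exists [ffun p => (m1 p + m2 p)%N].
by rewrite -big_split /=; apply: eq_bigr => p _; rewrite ffunE mulrnDr.
Qed.

Lemma root_sumZ r (v : 'cV[rat]_r) (c : int) : 0 <= c -> positive v ->
  root_sum (c%:~R *: v).
Proof.
case: c => // n _ /positiveP[p ->]; rewrite scaler_nat.
elim: n => [|n IH]; first by rewrite mulr0n; exact: root_sum0.
rewrite mulrS; apply: root_sumD IH; exists [ffun q => (q == p) : nat].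
rewrite (bigD1 p) //= ffunE eqxx big1 ?addr0 // => q /negPf qp.
by rewrite ffunE qp.
Qed.

Lemma root_sum_sum r n (F : nat -> 'cV[rat]_r) :
  (forall k, (k < n)%N -> root_sum (F k)) -> root_sum (\sum_(k < n) F k).
Proof.
by move=> h; elim/big_ind: _ => [||k _]; [exact: root_sum0|exact: root_sumD|exact: h].
Qed.

(** The condition that vec r s - rho r lies in the cone of the positive roots,
read from left to right: d is the sum of the coordinates already passed, and
the coordinate of rho at the head of s is the length of the tail. The last
entry is special because both eps_(r-1) - eps_r and eps_(r-1) + eps_r are simple
roots, so its absolute value has to be compensated by the earlier ones. *)
Fixpoint in_cone (d : int) (s : seq int) : bool :=
  match s with
  | [::] => true
  | [:: x] => `|x| <= d
  | x :: s' => (0 <= d + x - (size s')%:Z) && in_cone (d + x - (size s')%:Z) s'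
  end.

Lemma in_cone_cons (d x : int) s : (0 < size s)%N ->
  in_cone d (x :: s) =
  (0 <= d + x - (size s)%:Z) && in_cone (d + x - (size s)%:Z) s.
Proof. by case: s. Qed.

(** The sum of the first k coordinates of vec r s - rho r, as an integer. *)
Definition excess r s k : int := \sum_(i < k) (nth 0 s i - (r.-1 - i)%N%:Z).

Lemma excess0 r s : excess r s 0 = 0.
Proof. exact: big_ord0. Qed.

Lemma excessS r s k :
  excess r s k.+1 = excess r s k + (nth 0 s k - (r.-1 - k)%N%:Z).
Proof. exact: big_ord_recr. Qed.

Lemma excess_cons x s k :
  excess (size s).+1 (x :: s) k.+1 = x - (size s)%:Z + excess (size s) s k.
Proof.
rewrite /excess big_ord_recl /= subn0; congr (_ + _); apply: eq_bigr => i _.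
by rewrite /bump /= add1n; congr (_ - (_)%:Z); lia.
Qed.

(** The recursive condition unfolds to inequalities on partial sums. The one for the sum of
all but the last coordinate is implied by the bound on the last entry. *)
Lemma in_coneP d s : (0 < size s)%N ->
  reflect ((forall k, (k < (size s).-1)%N -> 0 <= d + excess (size s) s k.+1) /\
           `|nth 0 s (size s).-1| <= d + excess (size s) s (size s).-1)
    (in_cone d s).
Proof.
elim: s d => // x s IH d _; have [s0|s0] := posnP (size s).
  case: s s0 {IH} => // _ /=; rewrite excess0 addr0.
  by apply: (iffP idP) => [h|[]].
have e k : d + excess (size s).+1 (x :: s) k.+1 =
           d + x - (size s)%:Z + excess (size s) s k.
  by rewrite excess_cons !addrA.
have elast := e (size s).-1; rewrite prednK // in elast.
have nlast : nth 0 (x :: s) (size s) = nth 0 s (size s).-1.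
  by rewrite -{1}(prednK s0).
rewrite in_cone_cons //; apply: (iffP andP) => [[h0 /(IH _ s0)[h1 h2]]|[h1 h2]].
  split=> [[|k] hk|]; rewrite ?e ?excess0 ?addr0 //.
    by apply: h1; move: hk => /=; lia.
  by rewrite [(size (x :: s)).-1]/= nlast elast.
split; first by have := h1 0%N s0; rewrite e excess0 addr0.
apply/IH => //; split=> [k hk|].
  by rewrite -e; apply: h1 => /=; lia.
by rewrite -elast -nlast.
Qed.

Lemma dominant_root_sum_ge0 r (x xi : 'cV[rat]_r) :
  dominant x -> root_sum xi -> 0 <= dot x xi.
Proof.
move=> hx [m <-]; rewrite dotC dot_root_sum; apply: sumr_ge0 => p _.
by rewrite mulrn_wge0 // dominant_ge0 //; apply/positiveP; exists p.
Qed.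

Lemma coord_shift r s (k : 'I_r) :
  (vec r s - rho r) k 0 = (nth 0 s k - (r.-1 - k)%N%:Z)%:~R.
Proof. by rewrite rhoE !mxE rmorphB /=. Qed.

(** With e = 0 the left-hand vector is the sum of the first k coordinate vectors; with
k = r - 1 and e = 1 or -1 it is twice the highest weight of a half-spin representation. *)
Lemma excess_dot r s k (e : rat) : (k < r)%N ->
  dot (\col_(j < r) ((j < k)%:R + (j == k :> nat)%:R * e)) (vec r s - rho r) =
  (excess r s k)%:~R + e * (nth 0 s k - (r.-1 - k)%N%:Z)%:~R.
Proof.
move=> kr; rewrite /dot rmorph_sum /=.
rewrite (eq_bigr (fun i : 'I_r =>
  (if (i < k)%N then (nth 0 s i - (r.-1 - i)%N%:Z)%:~R else 0) +
  (if i == Ordinal kr then e * (nth 0 s i - (r.-1 - i)%N%:Z)%:~R else 0))); last first.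
  move=> i _; rewrite coord_shift mxE -val_eqE /= mulrDl.
  by congr (_ + _); case: ifP; rewrite ?mul1r ?mul0r.
rewrite big_split /= -!big_mkcond /= big_pred1_eq; congr (_ + _).
by rewrite (big_ord_widen r (fun i => (nth 0 s i - (r.-1 - i)%N%:Z)%:~R)) // ltnW.
Qed.

(** The inequalities are the pairings of a sum of positive roots with the dominant vectors of
[excess_dot]. *)
Lemma root_sum_cone r s : size s = r -> (1 < r)%N ->
  root_sum (vec r s - rho r) -> in_cone 0 s.
Proof.
move=> ss r1 h; apply/in_coneP; rewrite ss; first exact: ltnW.
have last_r : (r.-1 < r)%N by lia.
have spin e : `|e| = 1 ->
    0 <= (excess r s r.-1)%:~R + e * (nth 0 s r.-1 - (r.-1 - r.-1)%N%:Z)%:~R :> rat.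
  move=> he; rewrite -excess_dot //; apply: dominant_root_sum_ge0 h.
  move=> a b ab; rewrite !mxE.
  have -> : (a < r.-1)%N by have := ltn_ord b; lia.
  have -> : (a == r.-1 :> nat) = false by have := ltn_ord b; lia.
  rewrite mul0r addr0; case: ltngtP => hb;
    rewrite ?mul0r ?mul1r ?addr0 ?add0r ?he ?normr1 ?normr0 //.
split=> [k hk|].
  rewrite add0r -(ler0z rat).
  have := @excess_dot r s k.+1 0; rewrite mul0r addr0 => <-; last lia.
  apply: dominant_root_sum_ge0 h => a b ab; rewrite !mxE !mulr0 !addr0 normr_nat ler_nat.
  by case: ltnP => // hb; rewrite ltnS (leq_trans (ltnW ab)).
have := spin 1 (normr1 _); have := spin (-1) (normrN1 _).
rewrite subnn subr0 add0r mul1r mulN1r -rmorphN -!rmorphD /= !ler0z; lia.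
Qed.

(** Summation by parts, which expresses a vector on the simple roots eps_k - eps_(k+1) and one
remaining coordinate vector. *)
Lemma abel r s n : \sum_(k < n.+1) (nth 0 s k - (r.-1 - k)%N%:Z)%:~R *: eps r k =
  \sum_(k < n) (excess r s k.+1)%:~R *: (eps r k - eps r k.+1) +
  (excess r s n.+1)%:~R *: eps r n.
Proof.
elim: n => [|n IH].
  by rewrite big_ord_recr !big_ord0 /= !add0r excessS excess0 add0r.
rewrite big_ord_recr IH [in RHS]big_ord_recr /= (excessS r s n.+1) -addrA -[in RHS]addrA.
by rewrite (intrD _ (excess r s n.+1)) [in RHS]scalerDl scalerBr subrKA addrA.
Qed.

Lemma sum_level r : (1 < r)%N ->
  (\sum_(i < r) level r i = \sum_(i < r) (r.-1 - i) + 2)%N.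
Proof.
move=> r1; rewrite big_split /=; congr (_ + _)%N.
case: r r1 => [|[|r]] // _; rewrite !big_ord_recl big1 //.
Qed.

(** The absolute values of the entries sum to 2 more than the coordinates of rho, and a sign
change alters a sum by an even amount. *)
Lemma excess_even r s : arrangement r s -> (2 < r)%N ->
  exists b : int, excess r s r = b *+ 2.
Proof.
move=> hs r2.
have A : (\sum_(i < r) absz (nth 0%R s i) = \sum_(i < r) (r.-1 - i) + 2)%N.
  rewrite -sum_level ?(ltnW r2) //; have := perm_sumn hs.
  by rewrite !sumnE big_map big_image (big_nth 0) big_mkord (size_arrangement hs).
exists (1 - \sum_(i < r) (if nth 0 s i < 0 then `|nth 0 s i| else 0)).
have {}A : \sum_(i < r) `|nth 0 s i| = \sum_(i < r) (r.-1 - i)%N%:Z + 2.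
  have hP := big_morph Posz PoszD (erefl (Posz 0)).
  by have := congr1 Posz A; rewrite PoszD !hP.
rewrite /excess sumrB mulrnBl -sumrMnl -(addrK 2 (\sum_(i < r) _%:Z)) -A.
rewrite opprB addrCA -sumrB; congr (_ + _); rewrite -sumrN.
by apply: eq_bigr => i _; case: ifP; lia.
Qed.

(** Summation by parts leaves the last two coordinates, where
E (eps_(r-1) - eps_r) + E' eps_r = (E - b) (eps_(r-1) - eps_r) + b (eps_(r-1) + eps_r)
for the last two partial sums E and E' = 2 b. Both coefficients are nonnegative by the
condition on the last entry. *)
Lemma cone_root_sum r s : arrangement r s -> (2 < r)%N ->
  in_cone 0 s -> root_sum (vec r s - rho r).
Proof.
move=> hs r2; have ss := size_arrangement hs.
move/in_coneP; rewrite ss => /(_ ltac:(lia)) [h1 h2].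
have [b eb] := excess_even hs r2.
have er : r = r.-2.+2 by lia.
have -> : vec r s - rho r =
    \sum_(k < r.-2) (excess r s k.+1)%:~R *: (eps r k - eps r k.+1) +
    ((excess r s r.-1 - b)%:~R *: (eps r r.-2 - eps r r.-1) +
     b%:~R *: (eps r r.-2 + eps r r.-1)).
  transitivity (\sum_(k < r.-2.+2) (nth 0 s k - (r.-1 - k)%N%:Z)%:~R *: eps r k).
    rewrite -er; apply/matrixP => k z; rewrite !ord1 coord_shift summxE.
    rewrite (bigD1 k) //= big1 => [|j jk]; rewrite !mxE ?eqxx ?mulr1 ?addr0 //.
    by rewrite val_eqE eq_sym (negPf jk) mulr0.
  rewrite abel big_ord_recr /= -addrA -er eb; congr (_ + _).
  have -> : r.-2.+1 = r.-1 by lia.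
  by apply/matrixP => i j; rewrite !mxE rmorphB rmorphMn /=; ring.
have pos_pair k l (c : bool) : (k < l < r)%N -> positive (eps r k + (-1) ^+ c *: eps r l).
  move=> /andP[kl lr]; exists (Ordinal (ltn_trans kl lr)), (Ordinal lr).
  by split=> //; exists c.
have pos_sub k l : (k < l < r)%N -> positive (eps r k - eps r l).
  by move=> /(pos_pair _ _ true); rewrite expr1 scaleN1r.
have pos_add k l : (k < l < r)%N -> positive (eps r k + eps r l).
  by move=> /(pos_pair _ _ false); rewrite scale1r.
have elast : excess r s r = excess r s r.-1 + nth 0 s r.-1.
  by rewrite {2}(_ : r = r.-1.+1) ?excessS ?subnn ?subr0 //; lia.
apply: root_sumD.
  apply: (@root_sum_sum r _ (fun k => (excess r s k.+1)%:~R *: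
    (eps r k - eps r k.+1))) => k kr; apply: root_sumZ; last by apply: pos_sub; lia.
  by have := h1 k; rewrite add0r; apply; lia.
by apply: root_sumD; apply: root_sumZ; [lia|apply: pos_sub; lia|lia|apply: pos_add; lia].
Qed.

End Kostant.

(** * Counting admissible arrangements *)

Section Counting.
Local Open Scope ring_scope.

(** The value 0 has only one signed form, so that [letters] has no repetition. *)
Definition signs (a : nat) : seq int :=
  if a == 0%N then [:: 0] else [:: a%:Z; - a%:Z].

Definition letters (R : seq nat) : seq int := flatten (map signs R).

(** The arrangements of the n + 1 values of R that satisfy [in_cone] from the partial sum d on,
with n the next coordinate of rho. *)
Fixpoint fillings (n : nat) (d : int) (R : seq nat) : seq (seq int) :=
  if n is n'.+1 then
    [seq x :: s | x <- [seq x <- letters R | 0 <= d + x - n%:Z],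
                  s <- fillings n' (d + x - n%:Z) (rem `|x|%N R)]
  else [seq [:: x] | x <- letters R & `|x| <= d].

Lemma letters_cons a R : letters (a :: R) = signs a ++ letters R.
Proof. by []. Qed.

Lemma fillingsS n d R : fillings n.+1 d R =
  [seq x :: s | x <- [seq x <- letters R | 0 <= d + x - n.+1%:Z],
                s <- fillings n (d + x - n.+1%:Z) (rem `|x|%N R)].
Proof. by []. Qed.

Lemma mem_signs a x : (x \in signs a) = (`|x|%N == a).
Proof.
rewrite /signs; case: eqP => [->|ha]; rewrite !inE; first by lia.
by apply/idP/idP => [/orP[]/eqP -> //=|]; lia.
Qed.

Lemma mem_letters R x : (x \in letters R) = (`|x|%N \in R).
Proof.
apply/flatten_mapP/idP => [[a aR]|xR]; first by rewrite mem_signs => /eqP->.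
by exists `|x|%N => //; rewrite mem_signs.
Qed.

Lemma uniq_letters R : uniq R -> uniq (letters R).
Proof.
elim: R => //= a R IH /andP[aR uR]; rewrite /letters /= cat_uniq IH // andbT.
apply/andP; split.
  by rewrite /signs; case: eqP => //= ha; rewrite inE; lia.
apply/hasPn => x /=; rewrite mem_letters mem_signs => xR.
by apply: contraNneq aR => <-.
Qed.

Lemma mem_fillings n d R s : size R = n.+1 ->
  (s \in fillings n d R) = (perm_eq (map absz s) R && in_cone d s).
Proof.
elim: n d R s => [|n IH] d R s szR.
  case: R szR => [//|a []] //= _; apply/mapP/andP => [[x]|[]].
    rewrite mem_filter mem_letters inE => /andP[xd /eqP ha] -> /=.
    by rewrite ha perm_refl.
  case: s => [|x [|y s]] //=; try by move=> /perm_size.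
  move=> /perm_mem/(_ a); rewrite !inE eqxx => /eqP ha hd; exists x => //.
  by rewrite mem_filter mem_letters hd inE ha eqxx.
apply/allpairsPdep/andP => [[x [s' []]]|[]].
  rewrite mem_filter mem_letters => /andP[hd xR].
  have sz' : size (rem `|x|%N R) = n.+1 by rewrite size_rem // szR.
  rewrite IH // => /andP[ps hc] ->.
  have szs : size s' = n.+1 by rewrite -sz' -(perm_size ps) size_map.
  split.
    by rewrite /= (perm_trans _ (_ : perm_eq (`|x|%N :: rem `|x|%N R) R))
         ?perm_cons // perm_sym perm_to_rem.
  by rewrite in_cone_cons szs // hd.
case: s => [/perm_size/=|x s ps hc]; first by rewrite szR.
have xR : `|x|%N \in R by rewrite -(perm_mem ps) inE eqxx.
have ps' : perm_eq (map absz s) (rem `|x|%N R).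
  by rewrite -(perm_cons `|x|%N) (perm_trans ps) // perm_to_rem.
have sz' : size (rem `|x|%N R) = n.+1 by rewrite size_rem // szR.
have szs : size s = n.+1 by rewrite -sz' -(perm_size ps') size_map.
move: hc; rewrite in_cone_cons szs // => /andP[h0 hc].
by exists x, s; rewrite mem_filter mem_letters h0 IH // ps' hc.
Qed.

Lemma uniq_fillings n d R : uniq R -> uniq (fillings n d R).
Proof.
elim: n d R => [|n IH] d R uR.
  by rewrite map_inj_uniq ?filter_uniq ?uniq_letters // => x y [].
apply: allpairs_uniq_dep => [|x _|]; first by rewrite filter_uniq ?uniq_letters.
  by apply: IH; exact: rem_uniq.
by move=> [x s] [y t] _ _ /= [-> ->].
Qed.

(** When d <= n + 1 a negative entry would make the partial sum negative, so only positive
entries, or 0, can come first. *)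
Lemma size_fillings n (d : nat) R : (d <= n.+1)%N ->
  size (fillings n.+1 d R) =
  (\sum_(a <- R | n.+1 <= a + d)
     size (fillings n (a + d - n.+1)%N%:Z (rem a R)))%N.
Proof.
move=> hd; rewrite fillingsS size_allpairs_dep sumnE big_map big_filter.
elim: {1 3}R => [|a S IH]; first by rewrite !big_nil.
rewrite letters_cons big_cat /= IH big_cons /signs {IH}.
have shift b : (n < b + d)%N -> d%:Z + b%:Z - n.+1%:Z = (b + d - n.+1)%N by lia.
case: (eqVneq a 0%N) => [->|a0].
  rewrite big_cons big_nil; case: ifP => h1; case: ifP => h2; try lia.
  by rewrite shift // [in LHS]/= !addn0.
rewrite big_cons big_cons big_nil (ifF _ _ (_ : (0 <= d%:Z - a%:Z - n.+1%:Z) = false));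
  last by lia.
case: ifP => h1; case: ifP => h2; try lia.
by rewrite shift // [in LHS]/= !addn0.
Qed.

(** The values n-1, ..., 1, 0. *)
Fixpoint down n : seq nat := if n is m.+1 then m :: down m else [::].

Lemma mem_down n a : (a \in down n) = (a < n)%N.
Proof. by elim: n => [|n IH] /=; rewrite ?in_nil ?inE ?IH; lia. Qed.

(** Values below n + 1 - d are too small to come first; this leaves the finitely many
values of S. *)
Lemma size_fillings_down n (d : nat) S m : (d <= n.+1)%N -> (m + d <= n.+1)%N ->
  size (fillings n.+1 d (S ++ down m)) =
  (\sum_(a <- S | n.+1 <= a + d)
     size (fillings n (a + d - n.+1)%N%:Z (rem a (S ++ down m))))%N.
Proof.
move=> hd hm; rewrite size_fillings // big_cat /= [X in (_ + X)%N]big1_seq ?addn0 //.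
by move=> a /andP[h]; rewrite mem_down; lia.
Qed.

Arguments fillings : simpl never.

(** Numbers of completions when p is the next coordinate of rho. The suffix is the partition
that tells how the values already used differ from the largest ones (an entry c of the
partition marks a value replaced by the one c places lower), and the partial sum reached is
2 minus its size. *)
Definition count_0 p := size (fillings p 2 (down p.+1)).
Definition count_1 p := size (fillings p 1 (p.+1 :: down p)).
Definition count_2 p := size (fillings p 0 (p.+1 :: p :: down p.-1)).
Definition count_11 p := size (fillings p 0 (p.+2 :: down p)).

Lemma count_0S n : (0 < n)%N -> count_0 n.+1 = (count_0 n + count_1 n + count_2 n)%N.
Proof.
case: n => // n _; rewrite /count_0.
rewrite (@size_fillings_down n.+1 2 [:: n.+2; n.+1; n] n) ?addn2 //.
rewrite !big_cons big_nil /= !eqxx.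
rewrite !(ifT _ _ (_ : (n.+1 < _)%N)); try lia.
have -> : (n.+2 == n.+1) = false by lia.
have -> : (n.+2 == n) = false by lia.
have -> : (n.+1 == n) = false by lia.
by rewrite addn0 addnA /count_1 /count_2 /=; do !congr (_ + _)%N;
  congr (size (fillings _ _ _)); lia.
Qed.

Lemma count_1S n : count_1 n.+1 = (count_0 n + count_11 n)%N.
Proof.
rewrite /count_1 (@size_fillings_down n 1 [:: n.+2; n] n) ?addn1 //.
rewrite !big_cons big_nil /= !eqxx.
rewrite !(ifT _ _ (_ : (n < _)%N)); try lia.
have -> : (n.+2 == n) = false by lia.
by rewrite addn0 /count_0 /count_11 /=; congr (_ + _)%N; congr (size (fillings _ _ _)); lia.
Qed.

Lemma count_2S n : count_2 n.+1 = (count_1 n + count_11 n)%N.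
Proof.
rewrite /count_2 (@size_fillings_down n 0 [:: n.+2; n.+1] n) ?addn0 //.
rewrite !big_cons big_nil /= !eqxx.
rewrite !(ifT _ _ (_ : (n < _)%N)); try lia.
have -> : (n.+2 == n.+1) = false by lia.
by rewrite !addn0 /count_1 /count_11 /=; congr (_ + _)%N; congr (size (fillings _ _ _)); lia.
Qed.

Lemma count_11S n : count_11 n.+1 = count_0 n.
Proof.
rewrite /count_11 (@size_fillings_down n 0 [:: n.+3] n.+1) ?addn0 //.
rewrite !big_cons big_nil /= !eqxx.
rewrite !(ifT _ _ (_ : (n < _)%N)); try lia.
by rewrite !addn0 /count_0 /=; congr (size (fillings _ _ _)); lia.
Qed.

(** The base cases are taken here because a negative entry can occur only at the last two
coordinates (and is then -1). *)
Lemma count_at_1 : [/\ count_0 1 = 4, count_1 1 = 1, count_2 1 = 2 & count_11 1 = 1]%N.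
Proof. by []. Qed.

End Counting.

(** * The alternation sets *)

Section Cardinals.
Local Open Scope classical_set_scope.
Local Open Scope card_scope.
Local Open Scope ring_scope.
Implicit Types (r : nat) (s : seq int).

Lemma levelsE n : levels n.+4 = n.+4 :: n.+3 :: down n.+2.
Proof.
have size_down m : size (down m) = m by elim: m => //= m ->.
have nth_down m k : (k < m)%N -> nth 0%N (down m) k = (m.-1 - k)%N.
  by elim: m k => // m IH [|k] /= km; rewrite ?subn0 // IH //; lia.
apply: (@eq_from_nth _ 0%N); first by rewrite size_levels /= size_down.
move=> k; rewrite size_levels => kr; rewrite nth_levels // /level.
case: k kr => [|[|k]] kr; [by rewrite /=; lia | by rewrite /=; lia |].
rewrite -[RHS]/(nth 0%N (down n.+2) k) nth_down; lia.
Qed.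

(** The map g |-> g L is injective on the Weyl group with image the arrangements, so a set of
Weyl group elements defined by a condition on g L has as many elements as there are
arrangements satisfying it. *)
Lemma card_weyl_set r (A : set 'M[rat]_r) (P : pred (seq int)) l : (2 < r)%N ->
  uniq l -> (forall s, (s \in l) = arrangement r s && P s) ->
  (forall g s, weyl g -> g *m lambda_rho r = vec r s -> arrangement r s ->
     A g <-> P s) ->
  (forall g, A g -> weyl g) ->
  Defs.card A = size l.
Proof.
move=> r2 ul hl hP hA; have r1 := ltnW r2; apply: card_fset_set.
have imE : (fun g : 'M[rat]_r => g *m lambda_rho r) @` A = vec r @` [set` l].
  apply/seteqP; split=> v /=.
    case=> g Ag <-; have [s hs e] := weyl_arrangement r1 (hA g Ag).
    exists s; last by rewrite e.
    by rewrite hl hs; apply/(hP g s (hA g Ag) e hs).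
  case=> s; rewrite hl => /andP[hs Ps] <-.
  have [g wg e] := arrangement_weyl r2 hs; exists g => //.
  by apply/(hP g s wg e hs).
have h1 : (fun g : 'M[rat]_r => g *m lambda_rho r) @` A #= A.
  apply: inj_card_eq => g h; rewrite !inE => /hA wg /hA wh.
  exact: weyl_lambda_rho_inj.
have h2 : vec r @` [set` l] #= [set` l].
  apply: inj_card_eq => s t; rewrite !inE /= !hl => /andP[hs _] /andP[ht _].
  by apply: vec_inj; exact: size_arrangement.
have h3 : [set` l] #= `I_(size l).
  have -> : [set` l] = nth [::] l @` `I_(size l).
    apply/seteqP; split=> s /=.
      by move=> sl; exists (index s l); rewrite /= ?index_mem ?nth_index.
    by case=> k /= kl <-; exact: mem_nth.
  apply: inj_card_eq => i j; rewrite !inE /= => hi hj /eqP.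
  by rewrite nth_uniq // => /eqP.
by rewrite (card_eq_trans _ (card_eq_trans h2 h3)) // -imE card_eq_sym.
Qed.

Lemma Dset_cone r g s : (2 < r)%N -> weyl g -> g *m lambda_rho r = vec r s ->
  arrangement r s -> Dset g <-> in_cone 0 s.
Proof.
move=> r2 wg e hs; rewrite /Dset /= -/(lambda_rho r) e; split.
  case=> _ /kostant_gt0; apply: root_sum_cone; last exact: ltnW.
  exact: size_arrangement.
by move=> hc; split=> //; apply/kostant_gt0; exact: cone_root_sum.
Qed.

Lemma Mset_cone r g s : (2 < r)%N -> weyl g -> g *m lambda_rho r = vec r s ->
  arrangement r s -> Mset g <-> in_cone 0 s && (nth 0 s 0 == r%:Z).
Proof.
move=> r2 wg e hs; have r0 : (0 < r)%N by lia.
have := @avoids_s1P r g (Ordinal r0) r2 erefl wg.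
have -> : (g *m lambda_rho r) (Ordinal r0) 0 = (nth 0 s 0)%:~R by rewrite e mxE.
move=> [h1 h2]; split.
  case=> /(Dset_cone r2 wg e hs) -> /h1 /eqP.
  by rewrite -[r%:R]/(r%:Z%:~R) eqr_int.
by case/andP=> hc /eqP h; split; [apply/(Dset_cone r2 wg e hs)|apply: h2; rewrite h].
Qed.

Lemma Nset_cone r g s : (2 < r)%N -> weyl g -> g *m lambda_rho r = vec r s ->
  arrangement r s -> Nset g <-> in_cone 0 s && (nth 0 s 0 != r%:Z).
Proof.
move=> r2 wg e hs; have hD := Dset_cone r2 wg e hs; have hM := Mset_cone r2 wg e hs.
rewrite /Nset /=; split=> [[/hD hc nM]|/andP[hc h]].
  by rewrite hc; apply/negP => h; apply: nM; apply/hM; rewrite hc.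
by split; [apply/hD | move/hM; rewrite hc (negPf h)].
Qed.

Lemma uniq_down n : uniq (down n).
Proof. by elim: n => //= n ->; rewrite mem_down ltnn. Qed.

Lemma uniq_levels n : uniq (levels n.+4).
Proof.
rewrite levelsE /= !inE !mem_down uniq_down; lia.
Qed.

Lemma mem_fillings_levels n s :
  (s \in fillings n.+3 0 (levels n.+4)) = arrangement n.+4 s && in_cone 0 s.
Proof. by rewrite mem_fillings // size_levels. Qed.

Lemma cardD_count n : cardD n.+4 = count_2 n.+3.
Proof.
rewrite /count_2 -levelsE.
apply: (@card_weyl_set n.+4 _ (in_cone 0)) => //.
- exact/uniq_fillings/uniq_levels.
- exact: mem_fillings_levels.
- by move=> g s; exact: Dset_cone.
- by move=> g [].
Qed.

Lemma fillings_head n d R x s : 0 <= d + x - n.+1%:Z -> `|x|%N \in R ->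
  (s \in map (cons x) (fillings n (d + x - n.+1%:Z) (rem `|x|%N R))) =
  (s \in fillings n.+1 d R) && (nth 0 s 0 == x).
Proof.
move=> hx xR; rewrite fillingsS; apply/mapP/andP => [[t ht ->]|[]].
  split; last by rewrite /= eqxx.
  by apply/allpairsPdep; exists x, t; rewrite mem_filter hx mem_letters.
by move=> /allpairsPdep[y [t [_ ht ->]]] /= /eqP yx; exists t; rewrite -?yx.
Qed.

(** The first entry x satisfies 0 <= x - (r - 1), and r and r - 1 are the only such
values. *)
Lemma fillings_levels_head n s : s \in fillings n.+3 0 (levels n.+4) ->
  (nth 0 s 0 != n.+4%:Z) = (nth 0 s 0 == n.+3%:Z).
Proof.
rewrite fillingsS => /allpairsPdep[x [t [+ _ ->]]] /=.
by rewrite mem_filter mem_letters levelsE !inE mem_down; lia.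
Qed.

Lemma cardM_count n : cardM n.+4 = count_1 n.+2.
Proof.
have hx : 0 + n.+4%:Z - n.+3%:Z = 1 by lia.
rewrite /count_1 -(size_map (cons n.+4%:Z)).
apply: (@card_weyl_set n.+4 _ (fun s => in_cone 0 s && (nth 0 s 0 == n.+4%:Z))) => //.
- rewrite map_inj_uniq => [|s t []] //; apply: uniq_fillings.
  by have := uniq_levels n; rewrite levelsE => /andP[].
- move=> s; rewrite andbA -mem_fillings_levels -fillings_head ?hx ?levelsE ?mem_head //.
  by rewrite /= eqxx.
- by move=> g s; exact: Mset_cone.
- by move=> g [[]].
Qed.

Lemma cardN_count n : cardN n.+4 = count_11 n.+2.
Proof.
have hx : 0 + n.+3%:Z - n.+3%:Z = 0 by lia.
have hrem : rem n.+3 (levels n.+4) = n.+4 :: down n.+2.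
  by rewrite levelsE /= eqxx (_ : (n.+4 == n.+3) = false) //; lia.
rewrite /count_11 -(size_map (cons n.+3%:Z)).
apply: (@card_weyl_set n.+4 _ (fun s => in_cone 0 s && (nth 0 s 0 != n.+4%:Z))) => //.
- rewrite map_inj_uniq => [|s t []] //; apply: uniq_fillings.
  by rewrite -hrem rem_uniq // uniq_levels.
- move=> s; rewrite andbA -mem_fillings_levels -hrem.
  have := @fillings_head n.+2 0 (levels n.+4) n.+3 s.
  rewrite hx => -> //; last by rewrite levelsE !inE eqxx orbT.
  by case: (boolP (s \in _)) => // /fillings_levels_head ->.
- by move=> g s; exact: Nset_cone.
- by move=> g [[]].
Qed.

Lemma cardN_count_0 n : cardN n.+4 = count_0 n.+1.
Proof. by rewrite cardN_count count_11S. Qed.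

Lemma cardM_count_0 n : cardM n.+4 = (count_0 n.+1 + count_11 n.+1)%N.
Proof. by rewrite cardM_count count_1S. Qed.

Lemma cardD_split n : cardD n.+4 = (cardM n.+4 + cardN n.+4)%N.
Proof. by rewrite cardD_count cardM_count cardN_count count_2S. Qed.

Lemma count_0_rec n :
  (count_0 n.+4.+1 = count_0 n.+4 + count_0 n.+3 + 3 * count_0 n.+2 + count_0 n.+1)%N.
Proof. by rewrite count_0S // count_1S count_2S count_1S !count_11S; lia. Qed.

End Cardinals.

Theorem mainTheorem8 :
  (cardN 4 = 4 /\ cardN 5 = 7 /\ cardN 6 = 14 /\ cardN 7 = 34) /\
  forall r : nat, 8 <= r ->
    cardN r = cardN (r - 1) + cardN (r - 2) + 3 * cardN (r - 3)
              + cardN (r - 4) /\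
    (cardM r = cardN r + cardN (r - 1) /\
     cardM r = 2 * cardN (r - 1) + cardN (r - 2) + 3 * cardN (r - 3)
               + cardN (r - 4)) /\
    (cardD r = cardM r + cardN r /\
     cardD r = 2 * cardN r + cardN (r - 1) /\
     cardD r = 3 * cardN (r - 1) + 2 * cardN (r - 2) + 6 * cardN (r - 3)
               + 2 * cardN (r - 4)).
Proof.
have [f01 f11 fB1 fC1] := count_at_1; split.
  have f12 : count_1 2 = 5 by rewrite count_1S f01 fC1.
  have f02 : count_0 2 = 7 by rewrite count_0S // f01 f11 fB1.
  have f03 : count_0 3 = 14 by rewrite count_0S // f02 f12 count_2S f11 fC1.
  have f04 : count_0 4 = 34 by rewrite count_0S // f03 count_1S f02 count_2S f12 !count_11S f01.
  by rewrite (cardN_count_0 0) (cardN_count_0 1) (cardN_count_0 2) (cardN_count_0 3).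
move=> r r8; have -> : r = (r - 8).+4.+4 by lia.
move: (r - 8) => n.
rewrite !subSS !subn0.
have N : cardN n.+4.+4 = cardN n.+4.+3 + cardN n.+4.+2 + 3 * cardN n.+4.+1 + cardN n.+4.
  by rewrite !cardN_count_0 count_0_rec.
have M : cardM n.+4.+4 = cardN n.+4.+4 + cardN n.+4.+3.
  by rewrite cardM_count_0 !cardN_count_0 count_11S.
by rewrite cardD_split; lia.
Qed.
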